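(* Let $f:\mathbb{N}\to\mathbb{N}$ be a non-decreasing function satisfying the controlled growth requirement, and suppose $f(n) = \omega(n)$ and $f(n) = o(n^{3/2})$ as $n\to\infty$. Then $P(\mathcal{G}(f)) = [0,1]$.
   Context: Here $\mathbb{N}=\{1,2,\dots\}$. For a non-decreasing function $f:\mathbb{N}\to\mathbb{N}$, let $G_n$ be the grid graph with vertex set $[-f(n),f(n)]^2 \cap \mathbb{Z}^2$, with edges joining pairs of vertices at $L_1$-distance one, and let $\mathcal{G}(f) = (G_n, n\ge 1)$. An activator sequence on $\mathcal{G}(f)$ is a sequence $\mathcal{V} = (v_n, n\ge 1)$ with $v_n \in V(G_n)\cup\{\emptyset\}$ for all $n$, and $v_n \ne \emptyset$ for at least one $n$ (the sequence is ''non-empty''). Repeated vertices, and vertices that are already burning, are allowed; $v_n=\emptyset$ means no vertex is activated on turn $n$. The burning process: $B_0=\emptyset$ and, for $n\ge 1$, $B_n$ is the union of $B_{n-1}$, the set of all neighbours in $G_n$ of vertices of $B_{n-1}$, and $\{v_n\}$ if $v_n\neq\emptyset$. Define $\underline{\delta}(\mathcal{G}(f),\mathcal{V}) = \liminf_{n\to\infty} |B_n|/|V(G_n)|$ and $\overline{\delta}(\mathcal{G}(f),\mathcal{V}) = \limsup_{n\to\infty} |B_n|/|V(G_n)|$. If they are equal, the common value is the burning density $\delta(\mathcal{G}(f),\mathcal{V})$. Finally, $P(\mathcal{G}(f))$ is the set of $\rho\in[0,1]$ for which there is a (non-empty) activator sequence $\mathcal{V}$ on $\mathcal{G}(f)$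 such that $\delta(\mathcal{G}(f),\mathcal{V})$ exists and equals $\rho$. A function $f:\mathbb{N}\to\mathbb{N}$ satisfies the controlled growth requirement (has controlled growth) if: (i) $f(n+1)>f(n)$ for all sufficiently large $n$; (ii) for every function $\epsilon:\mathbb{N}\to\mathbb{N}$ with $\epsilon(n)=o(n)$ we have $f(n+\epsilon(n)) = (1+o(1))f(n)$; and (iii) for every constant $c>0$ there is a constant $d>0$ such that, for all sufficiently large $n$, $f(n+cn)\ge (1+d)f(n)$, where a non-integer argument $n+cn$ is read as $\lfloor n+cn\rfloor$. *)

(* Defs.v *)
From mathcomp Require Import all_boot all_order all_algebra.
From mathcomp Require Import finmap.
From mathcomp Require Import all_classical all_reals all_analysis.
From mathcomp Require Import zify.
Set Implicit Arguments.
Unset Strict Implicit.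
Unset Printing Implicit Defensive.
Import Order.TTheory GRing.Theory Num.Theory.
Import numFieldNormedType.Exports.
Local Open Scope fset_scope.
Local Open Scope classical_set_scope.
Local Open Scope ring_scope.

(* Time and the arguments of f range over {1, 2, ...}: functions of
   nat are used, and their value at 0 is never constrained. *)

Notation vertex := (int * int)%type.

Definition int_seg (k : nat) : {fset int} :=
  [fset (i%:Z - k%:Z) | i in iota 0 k.*2.+1].

Definition box (k : nat) : {fset vertex} :=
  [fset ((x, y) : vertex) | x in int_seg k, y in int_seg k].

Lemma mem_int_seg (k : nat) (x : int) :
  (x \in int_seg k) = (- k%:Z <= x <= k%:Z).
Proof.
apply/imfsetP/idP => [[i hi ->]|hx].
  have : i \in iota 0 k.*2.+1 by [].
  by rewrite mem_iota; lia.
exists (absz (x + k%:Z)); last by lia.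
by change (absz (x + k%:Z) \in iota 0 k.*2.+1); rewrite mem_iota; lia.
Qed.

Lemma mem_box (k : nat) (p : vertex) :
  (p \in box k) = (- k%:Z <= p.1 <= k%:Z) && (- k%:Z <= p.2 <= k%:Z).
Proof.
rewrite -!mem_int_seg; case: p => x y /=.
apply/imfset2P/andP => [[a /= ha [b /= hb [-> ->]]]//|[hx hy]].
by exists x => //; exists y.
Qed.

Definition l1_dist (u w : vertex) : int := `|u.1 - w.1| + `|u.2 - w.2|.

Definition grid_vertices (f : nat -> nat) (n : nat) : {fset vertex} := box (f n).

Definition grid_edge (f : nat -> nat) (n : nat) : rel vertex :=
  fun u w => [&& u \in grid_vertices f n, w \in grid_vertices f n
               & l1_dist u w == 1].

Definition neighbours (f : nat -> nat) (n : nat) (B : {fset vertex}) :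
    {fset vertex} :=
  [fset w in grid_vertices f n | has (fun u => grid_edge f n u w) B].

(* None stands for the empty activation. *)
Definition activator_sequence (f : nat -> nat) (v : nat -> option vertex) :
    Prop :=
  (forall n x, (0 < n)%N -> v n = Some x -> x \in grid_vertices f n) /\
  (exists2 n, (0 < n)%N & v n <> None).

Fixpoint burning (f : nat -> nat) (v : nat -> option vertex) (n : nat) :
    {fset vertex} :=
  if n is m.+1 then
    (burning f v m `|` neighbours f m.+1 (burning f v m)
      `|` (if v m.+1 is Some x then [fset x] else fset0))%fset
  else fset0.

Section Density.
Variable R : realType.

Definition burnt_fraction (f : nat -> nat) (v : nat -> option vertex)
    (n : nat) : R :=
  #|` burning f v n|%:R / #|` grid_vertices f n|%:R.

(* limn_inf and limn_sup are only meaningful on bounded real sequences;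
   here burnt_fraction takes its values in [0, 1]. *)
Definition lower_burning_density (f : nat -> nat) (v : nat -> option vertex) :
    R := limn_inf (burnt_fraction f v).

Definition upper_burning_density (f : nat -> nat) (v : nat -> option vertex) :
    R := limn_sup (burnt_fraction f v).

Definition has_burning_density (f : nat -> nat) (v : nat -> option vertex)
    (rho : R) : Prop :=
  lower_burning_density f v = rho /\ upper_burning_density f v = rho.

Definition burning_densities (f : nat -> nat) : set R :=
  [set rho | 0 <= rho <= 1 /\
    exists2 v, activator_sequence f v & has_burning_density f v rho].

Definition nat_seq (f : nat -> nat) : nat -> R := fun n => (f n)%:R.

Definition controlled_growth (f : nat -> nat) : Prop :=
  [/\ \forall n \near \oo, (f n < f n.+1)%N,
      forall e : nat -> nat, (forall n, (0 < n)%N -> (0 < e n)%N) ->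
        nat_seq e =o_\oo nat_seq id ->
        exists2 h : nat -> R, h @ \oo --> (0 : R) &
          \forall n \near \oo, (f (n + e n)%N)%:R = (1 + h n) * (f n)%:R
    & forall c : R, 0 < c -> exists2 d : R, 0 < d &
        \forall n \near \oo,
          (1 + d) * (f n)%:R <= (f (Num.truncn (n%:R + c * n%:R)))%:R].

End Density.

(* Main.v *)
Require Import Defs.
From mathcomp Require Import all_boot all_order all_algebra.
From mathcomp Require Import finmap.
From mathcomp Require Import all_classical all_reals all_analysis.
From mathcomp Require Import zify ring lra.
Import Order.TTheory GRing.Theory Num.Theory.
Import numFieldNormedType.Exports.
Local Open Scope classical_set_scope.
Local Open Scope ring_scope.

(** To reach density [rho], put [a = sqrt rho] and burn, at time [n],
    essentially the box of radius [g n], the integer part of [a * f n], and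
    little else.  This box fills a proportion about [a ^ 2 = rho] of the grid.

    Little else: if every vertex activated at a time [m] lies in [box (g m)],
    fire cannot leave [box (g n + n)] by time [n] ([burning_in_box]), and
    [n = o(f n)] makes the additional margin negligible.

    Essentially the box: time is cut into epochs, an epoch that begins at time
    [T] lasting [12 * d T] turns, where [d] is about [f `^ (2/3)].  In an epoch
    one activates a square lattice of spacing [d T] in [box (g T)].  The lattice
    has of order [(g T / d T) ^ 2 <= d T] points because [g ^ 2 <= d ^ 3], so
    they can all be activated within the epoch, leaving enough turns for
    the fires to meet; at the end of the epoch [box (g T)] is burnt
    ([sweep_burns_box]).  At an arbitrary time [n], the last completed epoch
    began at some [T] with [T <= n <= T + e T], where [e T] is the length of two
    consecutive epochs.  As [f = o(n `^ (3/2))], both [d] and [e] are [o(n)], and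
    the second clause of controlled growth gives [f (T + e T) ~ f T], whence
    [g T ~ a * f n] ([lag_ratio_cvg]).

    Squeezed between [box (g T)] and [box (g n + n)], the burnt set has density
    [a ^ 2 = rho].  For [rho = 0] the boxes [box (g T)] are single points and
    the same argument applies. *)

(** * Boxes and the spread of fire *)

Lemma box_subset (k l : nat) (p : int * int) :
  (k <= l)%N -> p \in box k -> p \in box l.
Proof. by rewrite !mem_box; lia. Qed.

Lemma card_box (k : nat) : #|` box k| = (k.*2.+1 ^ 2)%N.
Proof.
have segE : size (int_seg k) = k.*2.+1.
  rewrite -[LHS]/#|` int_seg k| card_in_imfset; last by move=> i j _ _ /=; lia.
  by rewrite -[RHS](size_iota 0) -[in RHS](undup_id (iota_uniq 0 k.*2.+1)).
rewrite -mulnn -{1}segE -segE -(size_allpairs pair).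
apply/perm_size/uniq_perm; first exact: fset_uniq.
  by apply: allpairs_uniq; [exact: fset_uniq | exact: fset_uniq | move=> [? ?] [? ?]].
move=> [x y]; rewrite [LHS]mem_box /= -!mem_int_seg.
by apply/andP/allpairsP => [[hx hy]|[[? ?] [hx hy [-> ->]]]] //; exists (x, y).
Qed.

Lemma in_neighbours (f : nat -> nat) (n : nat) (B : {fset int * int}) (p : int * int) :
  (p \in neighbours f n B) = (p \in box (f n)) && has (grid_edge f n ^~ p) B.
Proof. by rewrite mem_box -!mem_int_seg !inE. Qed.

Lemma burning_mono (f : nat -> nat) (v : nat -> option (int * int)) (m n : nat)
    (p : int * int) :
  (m <= n)%N -> p \in burning f v m -> p \in burning f v n.
Proof.
move=> /subnKC <-; elim: (n - m)%N => [|j IH] hp; first by rewrite addn0.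
by rewrite addnS /= !in_fsetU (IH hp).
Qed.

Lemma burning_step (f : nat -> nat) (v : nat -> option (int * int)) (m : nat)
    (p q : int * int) :
  p \in box (f m.+1) -> q \in box (f m.+1) -> l1_dist q p = 1 ->
  q \in burning f v m -> p \in burning f v m.+1.
Proof.
move=> hp hq hd hm; rewrite /= !in_fsetU; apply/orP; left; apply/orP; right.
rewrite in_neighbours hp; apply/hasP; exists q => //.
by rewrite /grid_edge /grid_vertices hp hq hd eqxx.
Qed.

(** The boundary of the grid never slows a fire between two vertices of the
    same box: a box is convex for the [L_1] distance, so a shortest path can be
    chosen inside the box of the activation time, and the later grids
    contain that box. *)
Lemma l1_ball_burns (f : nat -> nat) (v : nat -> option (int * int)) (i j : nat)
    (x p : int * int) :
  (forall m n, (0 < m)%N -> (m <= n)%N -> (f m <= f n)%N) ->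
  (0 < i)%N -> v i = Some x -> x \in box (f i) -> p \in box (f i) ->
  l1_dist x p <= j%:Z -> p \in burning f v (i + j).
Proof.
move=> fmono i0 vi hx; elim: j p => [|j IH] p hp hd.
  have -> : p = x.
    by move: hd; rewrite /l1_dist; case: p {hp} => a b; case: (x) => c d /= hd;
      congr pair; lia.
  by rewrite addn0; case: i i0 vi {hx hp hd} => //= m _ ->; rewrite !inE eqxx orbT.
have [hj|hj] := leP (l1_dist x p) j%:Z.
  by apply: (@burning_mono _ _ (i + j)); [lia | exact: IH].
rewrite addnS.
have grow : (f i <= f (i + j).+1)%N by apply: fmono => //; lia.
(* The last step of such a path: [q] is [p] moved by one towards [x], in the
   first coordinate on which they differ. *)
have [q [hq hqp hqx]] : exists q, [/\ q \in box (f i), l1_dist q p = 1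
    & l1_dist x q <= j%:Z].
  move: hx hp hd hj; rewrite !mem_box /l1_dist.
  case: x {vi IH} => a b; case: p => c d /= hx hp hd hj.
  have [ac|ac] := eqVneq a c.
    have [bd|bd] := leP b d; [exists (c, d - 1)|exists (c, d + 1)];
      rewrite ?mem_box /=; split; lia.
  have [acl|acl] := leP a c; [exists (c - 1, d)|exists (c + 1, d)];
    rewrite ?mem_box /=; split; lia.
apply: (@burning_step _ _ _ _ q) => //; try exact: box_subset grow _.
exact: IH.
Qed.

(** Every turn moves the fire by at most one in each coordinate, while new
    activations stay within [g]. *)
Lemma burning_in_box (f g : nat -> nat) (v : nat -> option (int * int)) (n : nat)
    (p : int * int) :
  (forall m n, (0 < m)%N -> (m <= n)%N -> (g m <= g n)%N) ->
  (forall m x, (0 < m)%N -> v m = Some x -> x \in box (g m)) ->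
  p \in burning f v n -> p \in box (g n + n).
Proof.
move=> gmono hv; elim: n p => [|n IH] p //=.
have IH' q : q \in burning f v n -> q \in box (g n.+1 + n).
  case: n IH => [|n] IH // /IH; apply: box_subset.
  by have := gmono n.+1 n.+2 isT (leqnSn _); lia.
rewrite !in_fsetU => /orP[/orP[/IH'|]|].
- by apply: box_subset; lia.
- rewrite in_neighbours => /andP[_ /hasP[q /IH' hq /and3P[_ _ /eqP]]].
  by move: hq; rewrite !mem_box /l1_dist; lia.
case E : (v n.+1) => [x|] //; rewrite inE => /eqP ->.
by apply: box_subset (hv _ _ _ E) => //; lia.
Qed.

(** * Division of time into epochs *)

(** The start of the epoch that contains time [n], when the epochs begin at
    time 1 and an epoch that begins at [T] lasts [L T] turns.  Recursion on [n]
    gives the start directly, without enumerating the epochs. *)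
Fixpoint epoch_start (L : nat -> nat) (n : nat) : nat :=
  if n is m.+1 then
    let T := epoch_start L m in if m.+1 == (T + L T)%N then m.+1 else T
  else 1%N.

Section Epochs.
Variable L : nat -> nat.
Hypothesis L_gt0 : forall n, (0 < L n)%N.

Lemma epoch_start_bounds n : (0 < n)%N -> (0 < epoch_start L n <= n)%N.
Proof.
elim: n => [//|n IH] _ /=; case: ifP => _; first by rewrite leqnn.
case: n IH => [//|n] IH; have := IH isT; lia.
Qed.

Lemma epoch_start_const T j :
  epoch_start L T = T -> (j < L T)%N -> epoch_start L (T + j) = T.
Proof.
move=> hT; elim: j => [|j IH] hj; first by rewrite addn0.
rewrite addnS /= IH ?(ltnW hj) //.
by case: eqP => // E; lia.
Qed.

Lemma epoch_start_next T :
  epoch_start L T = T -> epoch_start L (T + L T) = (T + L T)%N.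
Proof.
move=> hT; have hL := L_gt0 T.
have -> : (T + L T = (T + (L T).-1).+1)%N by lia.
by rewrite /= epoch_start_const ?prednK //; case: eqP; lia.
Qed.

(** When time advances by one, either the current epoch goes on, or it has just
    ended and takes the place of [T] as the last complete epoch. *)
Lemma complete_epoch n : (L 1 < n)%N ->
  exists T, [/\ (0 < T)%N, epoch_start L T = T, (T + L T <= n)%N
    & (n < T + L T + L (T + L T))%N].
Proof.
elim: n => [//|n IH]; rewrite ltnS leq_eqVlt => /orP[/eqP <-|/IH].
  exists 1%N; have := L_gt0 1; have := L_gt0 (1 + L 1) => h1 h2.
  by split => //=; [case: eqP; lia | lia].
move=> [T [T0 hT h1 h2]].
have [h|h] := ltnP n.+1 (T + L T + L (T + L T)); first by exists T; split => //; lia.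
exists (T + L T)%N; split; [lia | exact: epoch_start_next | lia |].
by have := L_gt0 (T + L T + L (T + L T)); lia.
Qed.

End Epochs.

(** * Covering a box by a lattice of activations *)

Definition sites_per_row (g d : nat) : nat := (g.*2 %/ d).+1.

(** The points of the lattice of spacing [d] based at the corner [(-g, -g)] of
    [box g], listed row by row. *)
Definition site (g d j : nat) : int * int :=
  ((d * (j %/ sites_per_row g d))%:Z - g%:Z,
   (d * (j %% sites_per_row g d))%:Z - g%:Z).

Lemma site_in_box g d j : (j < sites_per_row g d ^ 2)%N -> site g d j \in box g.
Proof.
move=> hj; rewrite mem_box /site /=.
have h1 : (j %/ sites_per_row g d <= g.*2 %/ d)%N.
  by rewrite -ltnS ltn_divLR //; rewrite -mulnn in hj.
have h2 : (j %% sites_per_row g d <= g.*2 %/ d)%N by rewrite -ltnS ltn_mod.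
have h k : (k <= g.*2 %/ d)%N -> (d * k <= g.*2)%N.
  by move=> hk; apply: (leq_trans _ (leq_divM g.*2 d)); rewrite mulnC leq_mul2r hk orbT.
by move: (h _ h1) (h _ h2); move: (d * (j %/ _))%N (d * (j %% _))%N => a b; lia.
Qed.

(** Rounding both coordinates down to the lattice moves a point by less than [d]
    in each. *)
Lemma sites_dense g d (p : int * int) : (0 < d)%N -> p \in box g ->
  exists2 j, (j < sites_per_row g d ^ 2)%N & l1_dist (site g d j) p <= d.*2%:Z.
Proof.
move=> d0; rewrite mem_box => hp.
pose i1 := ((absz (p.1 + g%:Z)%R) %/ d)%N; pose i2 := ((absz (p.2 + g%:Z)%R) %/ d)%N.
have K0 : (0 < sites_per_row g d)%N by [].
have h1 : (i1 < sites_per_row g d)%N by rewrite ltnS; apply: leq_div2r; lia.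
have h2 : (i2 < sites_per_row g d)%N by rewrite ltnS; apply: leq_div2r; lia.
exists (i1 * sites_per_row g d + i2)%N; first by rewrite -mulnn; nia.
rewrite /l1_dist /site divnMDl // modnMDl (divn_small h2) (modn_small h2) addn0 /=.
have := divn_eq (absz (p.1 + g%:Z)%R) d; have := ltn_pmod (absz (p.1 + g%:Z)%R) d0.
have := divn_eq (absz (p.2 + g%:Z)%R) d; have := ltn_pmod (absz (p.2 + g%:Z)%R) d0.
rewrite -/i1 -/i2 ![(d * _)%N]mulnC; lia.
Qed.

(** The quotient [q = 2 * g / d] has [q ^ 2 <= 4 * d], as
    [(q * d) ^ 2 <= 4 * g ^ 2 <= 4 * d ^ 3]; hence
    [(q + 1) ^ 2 <= 2 * q ^ 2 + 2 <= 10 * d]. *)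
Lemma few_sites g d : (0 < d)%N -> (g ^ 2 <= d ^ 3)%N ->
  (sites_per_row g d ^ 2 <= 10 * d)%N.
Proof.
move=> d0 hgd; rewrite /sites_per_row; have := leq_divM g.*2 d.
set q := (_ %/ _)%N => hq.
have : (q ^ 2 * d ^ 2 <= 4 * d * d ^ 2)%N.
  rewrite -expnMn; apply: (@leq_trans (g.*2 ^ 2)); first by rewrite leq_exp2r.
  by rewrite -muln2 expnMn; rewrite !expnS !expn0 in hgd *; lia.
by rewrite leq_pmul2r ?expn_gt0 ?d0 // => h; rewrite !expnS !expn0 in h *; nia.
Qed.

(** At most [10 * d] turns serve for the activations ([few_sites]); the
    remaining [2 * d] are enough for every vertex to be reached by the fire of
    a site near it ([sites_dense]). *)
Definition epoch_length (d : nat -> nat) (n : nat) : nat := (12 * d n)%N.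

(** In each epoch the sites of [box (g T)] are activated one per turn; the turns
    left over are idle. *)
Definition sweep (g d : nat -> nat) (n : nat) : option (int * int) :=
  let T := epoch_start (epoch_length d) n in
  if (n - T < sites_per_row (g T) (d T) ^ 2)%N
  then Some (site (g T) (d T) (n - T)) else None.

Section Sweep.
Variables f g d : nat -> nat.
Hypothesis f_mono : forall m n, (0 < m)%N -> (m <= n)%N -> (f m <= f n)%N.
Hypothesis g_mono : forall m n, (0 < m)%N -> (m <= n)%N -> (g m <= g n)%N.
Hypothesis g_le_f : forall n, (0 < n)%N -> (g n <= f n)%N.
Hypothesis d_gt0 : forall n, (0 < d n)%N.
Hypothesis d_large : forall n, (g n ^ 2 <= d n ^ 3)%N.

Local Notation L := (epoch_length d).

Lemma epoch_length_gt0 n : (0 < L n)%N.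
Proof. by rewrite /epoch_length muln_gt0 d_gt0. Qed.

Lemma sweep_in_box n x : (0 < n)%N -> sweep g d n = Some x -> x \in box (g n).
Proof.
move=> n0; rewrite /sweep; case: ifP => // hj [<-].
have /andP[T0 Tn] := epoch_start_bounds L n n0.
by apply: box_subset (site_in_box _ _ _ hj); exact: g_mono.
Qed.

Lemma sweep_activator : activator_sequence f (sweep g d).
Proof.
split; last by exists 1%N => //; rewrite /sweep /=; do 2 case: ifP => //; lia.
move=> n x n0 /(sweep_in_box _ _ n0); apply: box_subset; exact: g_le_f.
Qed.

(** When an epoch ends, each of its sites has been burning for at least
    [2 * d T] turns, which is the distance up to which the sites are dense. *)
Lemma sweep_burns_box n : (L 1 < n)%N ->
  exists T, [/\ (0 < T)%N, (T <= n < T + L T + L (T + L T))%N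
    & (box (g T) `<=` burning f (sweep g d) n)%fset].
Proof.
move=> /(complete_epoch _ epoch_length_gt0)[T [T0 hT h1 h2]].
exists T; split => //; first by rewrite h2 (leq_trans (leq_addr _ _) h1).
apply/fsubsetP => p hp.
have [j hj hd] := sites_dense (g T) (d T) p (d_gt0 T) hp.
have hjL : (j < 10 * d T)%N by apply: leq_trans (few_sites _ _ (d_gt0 T) (d_large T)).
have hs : epoch_start L (T + j) = T.
  by apply: epoch_start_const => //; rewrite /epoch_length; lia.
have grow : (g T <= f (T + j))%N.
  by apply: leq_trans (g_le_f T T0) _; apply: f_mono => //; lia.
apply: (@burning_mono _ _ (T + j + (d T).*2)).
  by apply: leq_trans h1; rewrite /epoch_length; lia.
apply: (l1_ball_burns f _ (T + j) _ (site (g T) (d T) j)) => //.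
- by lia.
- by rewrite /sweep hs addKn hj.
- exact: box_subset (site_in_box _ _ _ hj).
- exact: box_subset hp.
Qed.

End Sweep.

(** * Asymptotic estimates *)

Lemma nat_littleoP (R : realType) (u w : nat -> nat) :
  nat_seq R u =o_\oo nat_seq R w <->
  forall eps : R, 0 < eps -> \forall n \near \oo, (u n)%:R <= eps * (w n)%:R.
Proof.
split=> [/eqoP h eps eps0|h].
  by near=> n; have : `|nat_seq R u n| <= eps * `|nat_seq R w n|;
    [near: n; exact: h | rewrite !ger0_norm ?ler0n].
apply/eqoP => eps eps0; near=> n; rewrite !ger0_norm ?ler0n //.
by near: n; exact: h.
Unshelve. all: by end_near. Qed.

(** The exponent [2/3] balances the two phases of an epoch: with
    [d = f `^ (2/3)] the number [(f / d) ^ 2] of sites is of the order of [d],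
    the time that a fire takes to cross the gap between neighbouring sites. *)
Definition spacing (R : realType) (f : nat -> nat) (n : nat) : nat :=
  (Num.truncn ((f n)%:R `^ (2 / 3) : R)).+1.

Lemma spacing_large (R : realType) (f : nat -> nat) n :
  (f n ^ 2 <= spacing R f n ^ 3)%N.
Proof.
rewrite -(ler_nat R) !natrX.
have -> : (f n)%:R ^+ 2 = ((f n)%:R `^ (2 / 3)) ^+ 3 :> R.
  rewrite -!powR_mulrn ?powR_ge0 ?ler0n // -powRrM; congr powR; lra.
by rewrite lerXn2r ?nnegrE ?powR_ge0 ?ler0n // ltW // truncnS_gt.
Qed.

(** This is where [f = o(n `^ (3/2))] enters: it makes epochs short compared to
    the time elapsed. *)
Lemma spacing_littleo (R : realType) (f : nat -> nat) :
  nat_seq R f =o_\oo (fun n : nat => n%:R `^ (3 / 2) : R) ->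
  nat_seq R (spacing R f) =o_\oo nat_seq R id.
Proof.
move=> /eqoP fo; apply/nat_littleoP => eps eps0.
have c0 : 0 < eps / 2 by rewrite divr_gt0.
near=> n.
have hf : (f n)%:R <= (eps / 2 * n%:R) `^ (3 / 2).
  rewrite powRM ?(ltW c0) ?ler0n //.
  have : `|nat_seq R f n| <= (eps / 2) `^ (3 / 2) * `|n%:R `^ (3 / 2) : R|.
    by near: n; apply: fo; exact: powR_gt0.
  by rewrite !ger0_norm ?powR_ge0 ?ler0n.
have hr : (f n)%:R `^ (2 / 3) <= eps / 2 * n%:R.
  have : (f n)%:R `^ (2 / 3) <= ((eps / 2 * n%:R) `^ (3 / 2)) `^ (2 / 3).
    by apply: ge0_ler_powR => //; rewrite ?nnegrE ?ler0n ?powR_ge0 // divr_ge0.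
  rewrite -powRrM (_ : 3 / 2 * (2 / 3) = 1 :> R); last by field.
  by rewrite powRr1 // mulr_ge0 ?ler0n // ltW.
have hn : 1 <= eps / 2 * n%:R.
  rewrite mulrC -ler_pdivrMr //; near: n; exact: nbhs_infty_ger.
have /andP[ht _] := truncn_itv (powR_ge0 (f n)%:R (2 / 3) : 0 <= _ :> R).
rewrite /spacing -(addn1 (Num.truncn _)) natrD; lra.
Unshelve. all: by end_near. Qed.

Lemma epoch_span_littleo (R : realType) (d : nat -> nat) :
  nat_seq R d =o_\oo nat_seq R id ->
  nat_seq R (fun n => epoch_length d n + epoch_length d (n + epoch_length d n))%N
    =o_\oo nat_seq R id.
Proof.
move=> /nat_littleoP dn; apply/nat_littleoP => eps eps0.
(* If [L k <= c * k] for large [k], two epochs take at most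
   [c * n + c * (n + c * n)], which is at most [3 * c * n] once [c <= 1]. *)
pose c := Num.min 1 (eps / 3).
have c0 : 0 < c by rewrite lt_min ltr01 divr_gt0.
have /andP[c1 c2] : (c <= 1) && (c <= eps / 3) by rewrite -le_min.
have c12 : 0 < c / 12 by rewrite divr_gt0.
have [N _ hN] := dn _ c12.
have hL k : (N <= k)%N -> (epoch_length d k)%:R <= c * k%:R :> R.
  by move=> /hN /= hk; rewrite /epoch_length natrM; lra.
exists N => // n /= Nn; rewrite natrD.
have h1 := hL _ Nn.
have := hL (n + epoch_length d n)%N (leq_trans Nn (leq_addr _ _)).
rewrite natrD => h2.
have h3 : c * (epoch_length d n)%:R <= (epoch_length d n)%:R :> R by rewrite ler_piMl.
have h4 : c * n%:R <= eps / 3 * n%:R :> R by rewrite ler_wpM2r.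
lra.
Qed.

(** A box of radius [k] has side [2 * k + 1]; as [f] tends to infinity, the
    additional 1 disappears in the limit. *)
Lemma side_ratio_cvg (R : realType) (f w : nat -> nat) (a : R) :
  (forall n, (0 < n)%N -> (0 < f n)%N) ->
  ((f n)%:R^-1 : R) @[n --> \oo] --> (0 : R) ->
  ((w n)%:R / (f n)%:R : R) @[n --> \oo] --> a ->
  ((w n).*2.+1%:R / (f n).*2.+1%:R : R) @[n --> \oo] --> a.
Proof.
move=> f_pos f0 wf.
have lim : ((2 * ((w n)%:R / (f n)%:R) + (f n)%:R^-1) / (2 + (f n)%:R^-1) : R)
    @[n --> \oo] --> (2 * a + 0) / (2 + 0).
  apply: cvgM; first by apply: cvgD f0; apply: cvgM wf; exact: cvg_cst.
  by apply: cvgV; [rewrite addr0 | apply: cvgD f0; exact: cvg_cst].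
have -> : a = (2 * a + 0) / (2 + 0) by field.
apply: cvg_trans lim; apply: near_eq_cvg; near=> n.
have fn : 0 < (f n)%:R :> R by rewrite ltr0n f_pos //; near: n; exact: nbhs_infty_gt.
rewrite -(addn1 (w n).*2) -(addn1 (f n).*2) -!muln2 !natrD !natrM; field.
by rewrite !gt_eqF //=; lra.
Unshelve. all: by end_near. Qed.

Lemma littleo_ratio_cvg0 (R : realType) (f : nat -> nat) (u : nat -> nat) :
  nat_seq R u =o_\oo nat_seq R f -> (forall n, (0 < n)%N -> (0 < f n)%N) ->
  ((u n)%:R / (f n)%:R : R) @[n --> \oo] --> (0 : R).
Proof.
move=> /nat_littleoP uo f_pos; apply/cvgrPdist_le => eps eps0; near=> n.
have fn : 0 < (f n)%:R :> R by rewrite ltr0n f_pos //; near: n; exact: nbhs_infty_gt.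
rewrite sub0r normrN ger0_norm ?divr_ge0 // ler_pdivrMr //.
by near: n; exact: uo.
Unshelve. all: by end_near. Qed.

(** If [T n] lags behind [n] by at most [e (T n)] and [f] is insensitive to
    shifts by [e], then [f] does not distinguish [T n] from [n] in the limit:
    [f (T n) <= f n <= f (T n + e (T n)) = (1 + o(1)) * f (T n)]. *)
Lemma lag_ratio_cvg (R : realType) (f e T : nat -> nat) (h : nat -> R) :
  (forall n, (0 < n)%N -> (0 < f n)%N) ->
  (forall m n, (0 < m)%N -> (m <= n)%N -> (f m <= f n)%N) ->
  h @ \oo --> (0 : R) ->
  (\forall n \near \oo, (f (n + e n)%N)%:R = (1 + h n) * (f n)%:R) ->
  (\forall n \near \oo, (0 < T n)%N && (T n <= n <= T n + e (T n))%N) ->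
  T @ \oo --> \oo /\ ((f (T n))%:R / (f n)%:R : R) @[n --> \oo] --> (1 : R).
Proof.
move=> f_pos f_mono h0 fe Te.
have Too : T @ \oo --> \oo.
  apply/cvgnyPge => M; near=> n.
  have /andP[_ /andP[_ hn]] : (0 < T n)%N && (T n <= n <= T n + e (T n))%N.
    by near: n.
  rewrite leqNgt; apply/negP => TM.
  (* If [T n] were a number [i < M], then [n <= i + e i]; the sum bounds all
     these values at once. *)
  have : (\sum_(i < M) (i + e i) < n)%N by near: n; exact: nbhs_infty_gt.
  by rewrite (bigD1 (Ordinal TM)) //=; lia.
split => //.
have lim : ((1 + h (T n))^-1 : R) @[n --> \oo] --> ((1 + 0)^-1 : R).
  apply: cvgV; first by rewrite addr0 oner_neq0.
  by apply: cvgD; [exact: cvg_cst | exact: (cvg_comp _ _ Too h0)].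
rewrite addr0 invr1 in lim.
apply: squeeze_cvgr lim (cvg_cst _); near=> n.
have /andP[T0 /andP[Tn hn]] : (0 < T n)%N && (T n <= n <= T n + e (T n))%N.
  by near: n.
have fT : 0 < (f (T n))%:R :> R by rewrite ltr0n f_pos.
have fn : 0 < (f n)%:R :> R by rewrite ltr0n f_pos // (leq_trans T0).
have le1 : (f (T n))%:R <= (f n)%:R :> R by rewrite ler_nat f_mono.
have le2 : (f n)%:R <= (1 + h (T n)) * (f (T n))%:R.
  have <- : (f (T n + e (T n))%N)%:R = (1 + h (T n)) * (f (T n))%:R.
    by near: n; exact: Too fe.
  by rewrite ler_nat f_mono // (leq_trans T0).
have hpos : 0 < 1 + h (T n) by rewrite -(pmulr_lgt0 _ fT); exact: lt_le_trans le2.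
rewrite ler_pdivrMr // mul1r le1 andbT.
by rewrite ler_pdivlMr // mulrC ler_pdivrMr // mulrC.
Unshelve. all: by end_near. Qed.

Lemma truncn_ratio_cvg (R : realType) (f : nat -> nat) (a : R) : 0 <= a ->
  (forall n, (0 < n)%N -> (0 < f n)%N) ->
  ((f n)%:R^-1 : R) @[n --> \oo] --> (0 : R) ->
  ((Num.truncn (a * (f n)%:R))%:R / (f n)%:R : R) @[n --> \oo] --> a.
Proof.
move=> a0 f_pos f0.
have lim : (a - (f n)%:R^-1 : R) @[n --> \oo] --> a - 0.
  by apply: cvgB f0; exact: cvg_cst.
rewrite subr0 in lim; apply: squeeze_cvgr lim (cvg_cst _); near=> n.
have fn : 0 < (f n)%:R :> R by rewrite ltr0n f_pos //; near: n; exact: nbhs_infty_gt.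
have /andP[h1 h2] := truncn_itv (mulr_ge0 a0 (ltW fn)).
rewrite ler_pdivrMr // h1 andbT ler_pdivlMr // mulrBl mulVf ?gt_eqF //.
by rewrite -(addn1 (Num.truncn _)) natrD in h2; lra.
Unshelve. all: by end_near. Qed.

(** * The set of burning densities *)

Theorem theorem1p3 (R : realType) (f : nat -> nat)
  (f_pos : forall n, (0 < n)%N -> (0 < f n)%N)
  (f_nondecreasing : forall m n, (0 < m)%N -> (m <= n)%N -> (f m <= f n)%N)
  (f_controlled : controlled_growth R f)
  (* f(n) = omega(n) means n = o(f(n)) *)
  (f_omega : nat_seq R id =o_\oo nat_seq R f)
  (f_littleo : nat_seq R f =o_\oo (fun n : nat => n%:R `^ (3 / 2) : R)) :
  burning_densities f = [set rho : R | 0 <= rho <= 1].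
Proof.
apply/seteqP; split=> [rho []//|rho /= /andP[rho0 rho1]]; split; first by rewrite rho0.
have [_ f_stable _] := f_controlled.
pose a := Num.sqrt rho.
have a0 : 0 <= a by exact: sqrtr_ge0.
have a1 : a <= 1 by rewrite -sqrtr1 ler_wsqrtr.
pose g n := Num.truncn (a * (f n)%:R).
pose d := spacing R f.
pose e n := (epoch_length d n + epoch_length d (n + epoch_length d n))%N.
have g_itv n : (g n)%:R <= a * (f n)%:R :> R.
  by have /andP[] := truncn_itv (mulr_ge0 a0 (ler0n R (f n))).
have g_le_f n : (g n <= f n)%N.
  by rewrite -(ler_nat R) (le_trans (g_itv n)) // ler_piMl.
have g_mono m n : (0 < m)%N -> (m <= n)%N -> (g m <= g n)%N.
  by move=> m0 mn; rewrite le_truncn // ler_wpM2l // ler_nat f_nondecreasing.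
have d_large n : (g n ^ 2 <= d n ^ 3)%N.
  by apply: leq_trans (spacing_large R f n); rewrite leq_exp2r.
have d_gt0 n : (0 < d n)%N by [].
have e_gt0 n : (0 < n)%N -> (0 < e n)%N.
  by move=> _; rewrite addn_gt0 epoch_length_gt0.
have [h h0 fe] := f_stable e e_gt0 (epoch_span_littleo _ _ (spacing_littleo _ _ f_littleo)).
exists (sweep g d).
  by apply: sweep_activator.
(* [T n] is the start of the last epoch completed by time [n]; it is arbitrary
   as long as the first epoch lasts. *)
have /choice[T hT] n : exists t, (epoch_length d 1 < n)%N ->
    [/\ (0 < t)%N, (t <= n <= t + e t)%N
      & (box (g t) `<=` burning f (sweep g d) n)%fset].
  have [/(sweep_burns_box f g d f_nondecreasing (fun m _ => g_le_f m) d_gt0 d_large)|] :=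
    ltnP (epoch_length d 1) n; last by exists 0%N.
  move=> [t [t0 /andP[tn nt] sub]].
  by exists t => _; split => //; rewrite tn /e addnA ltnW.
have [Too fT] : T @ \oo --> \oo /\
    ((f (T n))%:R / (f n)%:R : R) @[n --> \oo] --> (1 : R).
  apply: (lag_ratio_cvg R f e T h) => //.
  near=> n; have [|-> -> _//] := hT n.
  by near: n; exact: nbhs_infty_gt.
have nf := littleo_ratio_cvg0 _ _ _ f_omega f_pos.
have f0 : ((f n)%:R^-1 : R) @[n --> \oo] --> (0 : R).
  apply: squeeze_cvgr (cvg_cst 0) nf; near=> n.
  rewrite invr_ge0 ler0n /= -[leLHS]mul1r ler_wpM2r ?invr_ge0 // ler1n.
  by near: n; exact: nbhs_infty_gt.
have gf := truncn_ratio_cvg _ _ _ a0 f_pos f0.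
have gTf : ((g (T n))%:R / (f n)%:R : R) @[n --> \oo] --> a.
  have lim : (((g (T n))%:R / (f (T n))%:R) * ((f (T n))%:R / (f n)%:R) : R)
      @[n --> \oo] --> a * 1.
    by apply: cvgM fT; exact: (cvg_comp _ _ Too gf).
  rewrite mulr1 in lim; apply: cvg_trans lim; apply: near_eq_cvg; near=> n.
  have [|T0 _ _] := hT n; first by near: n; exact: nbhs_infty_gt.
  by rewrite mulrA divfK // pnatr_eq0 -lt0n f_pos.
have gnf : ((g n + n)%:R / (f n)%:R : R) @[n --> \oo] --> a.
  under eq_cvg => n do rewrite natrD mulrDl.
  by rewrite -(addr0 a); exact: cvgD gf nf.
have lower := side_ratio_cvg _ _ _ _ f_pos f0 gTf.
have upper := side_ratio_cvg _ _ _ _ f_pos f0 gnf.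
suff lim : burnt_fraction R f (sweep g d) @ \oo --> rho.
  have cv : cvgn (burnt_fraction R f (sweep g d) : (R^o)^nat) by apply/cvg_ex; exists rho.
  split; rewrite /lower_burning_density /upper_burning_density.
    by rewrite (cvg_limn_infE cv); exact: cvg_lim.
  by rewrite (cvg_limn_supE cv); exact: cvg_lim.
rewrite -(sqr_sqrtr rho0) -/a expr2.
apply: squeeze_cvgr (cvgM lower lower) (cvgM upper upper); near=> n.
have [|_ _ sub] := hT n; first by near: n; exact: nbhs_infty_gt.
have sup : (burning f (sweep g d) n `<=` box (g n + n))%fset.
  apply/fsubsetP => p; apply: burning_in_box => // m x; exact: sweep_in_box.
move: (fsubset_leq_card sub) (fsubset_leq_card sup).
rewrite /burnt_fraction /grid_vertices !card_box -!(ler_nat R) /= => lo up.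
rewrite -!expr2 !expr_div_n -!natrX.
by apply/andP; split; rewrite ler_wpM2r ?invr_ge0.
Unshelve. all: by end_near. Qed.
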